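(* Let $A$ be a two-sided skew brace of nilpotent type, i.e. such that $(A,+)$ is nilpotent. Then the following properties are equivalent: (1) $A$ is left nilpotent; (2) $A$ is right nilpotent; (3) $A$ is strongly nilpotent.
   Context: A skew (left) brace is a triple $(A,+,\circ)$ such that $(A,+)$ and $(A,\circ)$ are (not necessarily abelian) groups and $a\circ(b+c)=a\circ b-a+a\circ c$ for all $a,b,c\in A$. The two groups share the same identity element, denoted $0$. It is two-sided if moreover $(a+b)\circ c=a\circ c-c+b\circ c$ for all $a,b,c\in A$. For $a,b\in A$ put $a*b=-a+a\circ b-b$; for $X,Y\subseteq A$ let $X*Y$ be the subgroup of $(A,+)$ generated by $\{x*y\mid x\in X,y\in Y\}$. Set $A^{(1)}=A^1=A^{[1]}=A$ and, for $n\ge1$: $A^{(n+1)}=A^{(n)}*A$; $A^{n+1}=A*A^n$; and $A^{[n+1]}$ is the subgroup of $(A,+)$ generated by $\bigcup_{1\le i\le n}A^{[i]}*A^{[n+1-i]}$. The skew brace $A$ is right nilpotent if $A^{(n)}=\{0\}$ for some $n$, left nilpotent if $A^n=\{0\}$ for some $n$, and strongly nilpotent if $A^{[n]}=\{0\}$ for some $n$. *)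

(* Defs.v *)
From mathcomp Require Import all_boot.
From mathcomp Require Import boolp classical_sets.

Set Implicit Arguments.
Unset Strict Implicit.
Unset Printing Implicit Defensive.

Declare Scope brace_scope.
Delimit Scope brace_scope with brace.

Local Open Scope classical_set_scope.

Record is_group (T : Type) (op : T -> T -> T) (e : T) (inv : T -> T) : Prop :=
  IsGroup {
    is_group_assoc : associative op;
    is_group_id_l : left_id e op;
    is_group_id_r : right_id e op;
    is_group_inv_l : left_inverse e inv op;
    is_group_inv_r : right_inverse e inv op
  }.

(* The identity [sb_one] of the circle group is a separate field: that it      *)
(* equals [sb_zero] is a consequence of the axioms, see [sb_one_zero].         *)
Record skewBrace : Type := SkewBrace {
  sb_sort :> Type;
  sb_add : sb_sort -> sb_sort -> sb_sort;
  sb_zero : sb_sort;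
  sb_opp : sb_sort -> sb_sort;
  sb_circ : sb_sort -> sb_sort -> sb_sort;
  sb_one : sb_sort;
  sb_inv : sb_sort -> sb_sort;
  sb_add_group : is_group sb_add sb_zero sb_opp;
  sb_circ_group : is_group sb_circ sb_one sb_inv;
  sb_left_distr : forall a b c : sb_sort,
    sb_circ a (sb_add b c) =
    sb_add (sb_add (sb_circ a b) (sb_opp a)) (sb_circ a c)
}.

Arguments sb_zero {_}.
Arguments sb_one {_}.

Bind Scope brace_scope with sb_sort.

Notation "0" := (@sb_zero _) : brace_scope.
Notation "a + b" := (sb_add a b) : brace_scope.
Notation "- a" := (sb_opp a) : brace_scope.
Notation "a - b" := (sb_add a (sb_opp b)) : brace_scope.
Notation "a \circ b" := (sb_circ a b)
  (at level 40, left associativity) : brace_scope.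

Local Open Scope brace_scope.

Section SkewBrace.

Variable A : skewBrace.
Implicit Types (a b c x y : A) (X Y H : set A) (n : nat).

Lemma sb_one_zero : @sb_one A = 0.
Proof.
have [addA add0 addr0 addN addrN] := sb_add_group A.
have [circA circ1 circr1 circV circVr] := sb_circ_group A.
have := sb_left_distr (@sb_one A) 0 0; rewrite !circ1 !add0 addr0.
by move/(congr1 (sb_add sb_one)); rewrite addr0 addrN.
Qed.

Definition two_sided : Prop :=
  forall a b c, (a + b) \circ c = a \circ c - c + b \circ c.

Definition add_subgroup H : Prop :=
  [/\ H 0, forall x y, H x -> H y -> H (x + y) & forall x, H x -> H (- x)].

Definition add_gen X : set A := smallest add_subgroup X.

Definition star a b : A := - a + a \circ b - b.

Definition star_set X Y : set A := add_gen [set star x y | x in X & y in Y].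

(* All the series below start at index 1; their value at 0 is irrelevant.      *)

Definition right_series n : set A := iter n.-1 (star_set^~ setT) setT.

Definition left_series n : set A := iter n.-1 (star_set setT) setT.

(* [strong_table m k] is A^[k] for 1 <= k <= m.+1; the recursion for A^[n] is  *)
(* stated by [strong_series1] and [strong_seriesS].                            *)
Fixpoint strong_table (m : nat) : nat -> set A :=
  if m is m'.+1 then
    fun k => if (k <= m)%N then strong_table m' k else
      add_gen (\bigcup_(i in [set i | (1 <= i <= m)%N])
                 star_set (strong_table m' i) (strong_table m' (m.+1 - i)))
  else fun=> setT.

Definition strong_series n : set A := strong_table n.-1 n.

Lemma strong_tableE m k : (1 <= k <= m.+1)%N ->
  strong_table m k = strong_series k.
Proof.
elim: m => [|m IHm]; first by case: k => [|[|k]].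
case/andP=> k0; rewrite leq_eqVlt => /orP[/eqP -> //|km].
by rewrite /= -ltnS km IHm // k0.
Qed.

Lemma right_series1 : right_series 1 = setT. Proof. by []. Qed.

Lemma right_seriesS n : (1 <= n)%N ->
  right_series n.+1 = star_set (right_series n) setT.
Proof. by case: n. Qed.

Lemma left_series1 : left_series 1 = setT. Proof. by []. Qed.

Lemma left_seriesS n : (1 <= n)%N ->
  left_series n.+1 = star_set setT (left_series n).
Proof. by case: n. Qed.

Lemma strong_series1 : strong_series 1 = setT. Proof. by []. Qed.

Lemma strong_seriesS n : (1 <= n)%N ->
  strong_series n.+1 =
  add_gen (\bigcup_(i in [set i | (1 <= i <= n)%N])
             star_set (strong_series i) (strong_series (n.+1 - i))).
Proof.
case: n => // n _; rewrite {1}/strong_series /= ltnn; congr add_gen.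
apply: eq_bigcupr => i /= /andP[i0 ile].
rewrite !strong_tableE ?i0 //.
by rewrite subn_gt0 ltnS ile leq_subLR -addn1 addnC leq_add2r.
Qed.

Definition right_nilpotent : Prop :=
  exists2 n, (1 <= n)%N & right_series n = [set 0].

Definition left_nilpotent : Prop :=
  exists2 n, (1 <= n)%N & left_series n = [set 0].

Definition strongly_nilpotent : Prop :=
  exists2 n, (1 <= n)%N & strong_series n = [set 0].

Definition add_commutator x y : A := - x - y + x + y.

Definition lower_central_series n : set A :=
  iter n.-1
    (fun X => add_gen [set add_commutator x y | x in X & y in setT]) setT.

Definition nilpotent_type : Prop :=
  exists2 n, (1 <= n)%N & lower_central_series n = [set 0].

End SkewBrace.

(* Main.v *)
(* For a set G of endomorphisms of (A, +), let [H, G] be the subgroup          *)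
(* generated by the elements - h + f h with h in H and f in G. Since           *)
(* x * y = - x + mu_y x and x * y = - (- (- y) + lambda_x (- y)), where the    *)
(* maps lambda_x are endomorphisms, and so are the mu_y as A is two-sided, the *)
(* right and the left series are [A, mu, ..., mu] and [A, lambda, ..., lambda].*)
(*   The maps lambda_x and mu_y commute modulo the commutator subgroup A' of   *)
(* (A, +), and [A, lambda] = [A, mu] = A * A. Hence, if either series reaches  *)
(* 0, then the series of G = lambda U mu reaches A'. As in P. Hall's           *)
(* nilpotency criterion, the series of G goes from the k-th term of the lower  *)
(* central series to the next one for every k, by induction on k, because an   *)
(* endomorphism acts on a commutator through both of its arguments; so the     *)
(* series of G reaches 0. Finally A^[2^k] is contained in [A, G, ..., G] with  *)
(* k copies of G.                                                              *)

From mathcomp Require Import all_boot.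
From mathcomp Require Import boolp classical_sets.
Require Import Defs.

Set Implicit Arguments.
Unset Strict Implicit.
Unset Printing Implicit Defensive.

Local Open Scope classical_set_scope.
Local Open Scope brace_scope.

(** Two-sidedness makes both actions [lambda] and [mu] additive, so all three properties become
    statements about endomorphisms displacing the nilpotent group (A, +). Either one-sided
    hypothesis controls the joint action on the abelianization A/A' ([lambda_mu_comm],
    [disp_setU_sub]). This control climbs the lower central series ([disp_lcsS], [disp_nilpotent]):
    each factor is generated by commutators, hence is an image of the tensor product of the previous
    factor with A/A'. There f - 1 acts as (f - 1) ⊗ 1 + 1 ⊗ (f - 1) + (f - 1) ⊗ (f - 1), which
    deepens at least one argument. The strong series then vanishes by [strong_series_disp];
    conversely it contains both one-sided series. *)

Section Nilpotency.

Variable A : skewBrace.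
Implicit Types (a b c x y z : A) (X Y H N : set A) (f g : A -> A).
Implicit Types (G : set (A -> A)) (i j k m n : nat).

(** * Group arithmetic and generated subgroups *)

Let addA : associative (@sb_add A). Proof. by case: (sb_add_group A). Qed.
Let add0r : left_id 0 (@sb_add A). Proof. by case: (sb_add_group A). Qed.
Let addr0 : right_id 0 (@sb_add A). Proof. by case: (sb_add_group A). Qed.
Let addNr : left_inverse 0 (@sb_opp A) (@sb_add A).
Proof. by case: (sb_add_group A). Qed.
Let addrN : right_inverse 0 (@sb_opp A) (@sb_add A).
Proof. by case: (sb_add_group A). Qed.
Let addrK x y : x + y - y = x. Proof. by rewrite -addA addrN addr0. Qed.
Let addrNK x y : x - y + y = x. Proof. by rewrite -addA addNr addr0. Qed.

Let addIr z x y : x + z = y + z -> x = y.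
Proof. by move/(congr1 (fun t => t - z)); rewrite !addrK. Qed.

Let oppK : involutive (@sb_opp A).
Proof. by move=> x; apply: (@addIr (- x)); rewrite addNr addrN. Qed.

Let oppD x y : - (x + y) = - y - x.
Proof. by apply: (@addIr (x + y)); rewrite addNr addA addrNK addNr. Qed.

Let opp0 : - 0 = 0 :> A.
Proof. by apply: (@addIr 0); rewrite addNr addr0. Qed.

(* A complete rewriting system for the word problem in free groups. *)
Let groupE := (addA, oppD, oppK, opp0, add0r, addr0, addNr, addrN, addrK, addrNK).

Let circA : associative (@sb_circ A).
Proof. by case: (sb_circ_group A). Qed.

Local Notation comm := (@add_commutator A).

Lemma add_gen_subgroup X : add_subgroup (add_gen X).
Proof.
split=> [H [[]] // | x y Xx Xy H sXH | x Xx H sXH].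
  by have [[_ HD _] _] := sXH; apply: HD; [apply: Xx | apply: Xy].
by have [[_ _ HN] _] := sXH; apply: HN; apply: Xx.
Qed.

Lemma sub_add_gen X : X `<=` add_gen X.
Proof. by move=> x Xx H [_ sXH]; apply: sXH. Qed.

Lemma add_gen_sub X H : add_subgroup H -> X `<=` H -> add_gen X `<=` H.
Proof. by move=> subH sXH x Xx; apply: Xx. Qed.

Lemma add_genS X Y : X `<=` Y -> add_gen X `<=` add_gen Y.
Proof.
move=> sXY; apply: add_gen_sub; first exact: add_gen_subgroup.
by apply: subset_trans sXY _; apply: sub_add_gen.
Qed.

(** * Endomorphisms and displacement subgroups *)

Definition add_normal N :=
  add_subgroup N /\ forall x y, N x -> N (- y + x + y).

Definition endo f := {morph f : x y / x + y}.

Lemma endo0 f : endo f -> f 0 = 0.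
Proof. by move=> fD; apply: (@addIr (f 0)); rewrite -fD !add0r. Qed.

Lemma endoN f x : endo f -> f (- x) = - f x.
Proof. by move=> fD; apply: (@addIr (f x)); rewrite -fD !addNr (endo0 fD). Qed.

Lemma endo_comm f x y : endo f -> f (comm x y) = comm (f x) (f y).
Proof. by move=> fD; rewrite /add_commutator !fD !(endoN _ fD). Qed.

(* The commutator subgroup [H, G], taken in the holomorph of (A, +). *)
Definition displacement G H : set A :=
  add_gen [set - x + f x | x in H & f in G].

Local Notation disp := displacement.

Lemma disp_mem G H f x : G f -> H x -> disp G H (- x + f x).
Proof. by move=> Gf Hx; apply: sub_add_gen; exists x => //; exists f. Qed.

Lemma dispS G H K : H `<=` K -> disp G H `<=` disp G K.
Proof.
move=> sHK; apply: add_genS => _ [x Hx [f Gf <-]].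
by exists x; [apply: sHK | exists f].
Qed.

Lemma iter_dispS G H K n :
  H `<=` K -> iter n (disp G) H `<=` iter n (disp G) K.
Proof. by move=> sHK; elim: n => //= n; apply: dispS. Qed.

(** This is the set where two homomorphisms from A to A/N, the projection and its composite with
    [f], agree. It allows displacements to be checked on generators. *)
Lemma displacement_subgroup f N : endo f -> add_normal N ->
  add_subgroup [set x | N (- x + f x)].
Proof.
move=> fD [[N0 ND NN] NJ]; split=> /= [|x y Nx Ny|x Nx].
- by rewrite (endo0 fD) addr0 opp0.
- rewrite fD; have ->: - (x + y) + (f x + f y) =
    - y + (- x + f x) + y + (- y + f y) by rewrite !groupE.
  by apply: ND => //; apply: NJ.
- rewrite (endoN _ fD); have ->: - - x - f x = - (- - x + (- x + f x) - x).
    by rewrite !groupE.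
  by apply: NN; apply: NJ.
Qed.

Lemma disp_gen_sub G X N : G `<=` endo -> add_normal N ->
  (forall x f, X x -> G f -> N (- x + f x)) ->
  disp G (add_gen X) `<=` N.
Proof.
move=> endoG nN XN; apply: add_gen_sub; first by case: nN.
move=> _ [x Xx [f Gf <-]].
have subP := displacement_subgroup (endoG f Gf) nN.
by apply: (add_gen_sub subP _ Xx) => y Xy; apply: XN.
Qed.

Lemma iter_disp_subgroup G H n : add_subgroup H ->
  add_subgroup (iter n (disp G) H).
Proof. by case: n => //= n _; apply: add_gen_subgroup. Qed.

(** * The lower central series *)

(* [lcs k] is the term of index k + 1 in the lower central series. *)
Definition lcs k : set A := lower_central_series k.+1.

Lemma lcsS k :
  lcs k.+1 = add_gen [set comm x y | x in lcs k & y in setT].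
Proof. by []. Qed.

Lemma setT_subgroup : add_subgroup (@setT A). Proof. by []. Qed.

Lemma lcs_subgroup k : add_subgroup (lcs k).
Proof. by case: k => [|k]; [exact: setT_subgroup | exact: add_gen_subgroup]. Qed.

Lemma lcs_comm k x y : lcs k x -> lcs k.+1 (comm x y).
Proof. by move=> kx; apply: sub_add_gen; exists x => //; exists y. Qed.

Lemma lcsW k : lcs k.+1 `<=` lcs k.
Proof.
elim: k => [//|k IHk]; apply: add_genS => _ [x kx [y _ <-]].
by exists x; [apply: IHk | exists y].
Qed.

(** Conjugation by [y] changes [x] by [comm x y], which already lies in [lcs k.+1]. *)
Lemma normal_between_lcs k N :
  add_subgroup N -> lcs k.+1 `<=` N -> N `<=` lcs k -> add_normal N.
Proof.
move=> subN sN Ns; split=> // x y Nx; have [_ ND _] := subN.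
have ->: - y + x + y = x + comm x y by rewrite /add_commutator !groupE.
by apply: ND => //; apply: sN; apply: lcs_comm; apply: Ns.
Qed.

Lemma lcs_normal k : add_normal (lcs k).
Proof. exact: normal_between_lcs (@lcs_subgroup k) (@lcsW k) (fun _ => id). Qed.

Lemma lcs0 k : lcs k 0.
Proof. by have [] := lcs_subgroup k. Qed.

Lemma lcsD k x y : lcs k x -> lcs k y -> lcs k (x + y).
Proof. by have [_ lcsD _] := lcs_subgroup k; apply: lcsD. Qed.

Lemma lcsN k x : lcs k x -> lcs k (- x).
Proof. by have [_ _ lcsN] := lcs_subgroup k; apply: lcsN. Qed.

Lemma lcsJ k x y : lcs k x -> lcs k (- y + x + y).
Proof. by have [_ lcsJ] := lcs_normal k; apply: lcsJ. Qed.

Lemma lcs_endo k f x : endo f -> lcs k x -> lcs k (f x).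
Proof.
move=> fD; elim: k x => [//|k IHk].
apply: (@add_gen_sub _ [set x | lcs k.+1 (f x)]).
  by split=> /= [|x y|x]; rewrite ?(endo0 fD) ?fD ?(endoN _ fD);
    [apply: lcs0 | apply: lcsD | apply: lcsN].
move=> _ [x kx [y _ <-]] /=; rewrite (endo_comm _ _ fD).
by apply: lcs_comm; apply: IHk.
Qed.

Lemma disp_lcs G k : G `<=` endo -> disp G (lcs k) `<=` lcs k.
Proof.
move=> endoG; apply: add_gen_sub (lcs_subgroup k) _ => _ [x kx [f Gf <-]].
by apply: lcsD; [apply: lcsN | apply: lcs_endo => //; apply: endoG].
Qed.

Lemma iter_disp_lcs G k n : G `<=` endo -> iter n (disp G) (lcs k) `<=` lcs k.
Proof.
move=> endoG; elim: n => //= n IHn.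
by apply: subset_trans (dispS IHn) _; apply: disp_lcs.
Qed.

(** Endomorphisms preserve [lcs k], so a series that has entered it never leaves. *)
Lemma iter_disp_stable G H k m n : G `<=` endo -> (m <= n)%N ->
  iter m (disp G) H `<=` lcs k -> iter n (disp G) H `<=` lcs k.
Proof.
move=> endoG le_mn sHk; rewrite -(subnK le_mn) iterD.
exact: subset_trans (iter_dispS sHk) (iter_disp_lcs endoG).
Qed.

(** An instance of the three subgroups lemma: modulo [lcs k.+2], the commutator with an element of
    [lcs k] depends on [y] only through its class in A/A'. *)
Lemma comm_lcs1 k x y : lcs k x -> lcs 1 y -> lcs k.+2 (comm x y).
Proof.
move=> kx.
apply: (@add_gen_sub _ [set y | lcs k.+2 (comm x y)]).
  split=> /= [|u v Hu Hv|u Hu].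
  - by rewrite /add_commutator !groupE; apply: lcs0.
  - have ->: comm x (u + v) = comm x v + (- v + comm x u + v).
      by rewrite /add_commutator !groupE.
    by apply: lcsD => //; apply: lcsJ.
  - have ->: comm x (- u) = - - u + - comm x u + - u.
      by rewrite /add_commutator !groupE.
    by apply: lcsJ; apply: lcsN.
move=> _ [u _ [v _ <-]] /=.
(* The Hall-Witt identity. *)
have ->: comm x (comm u v) =
  - (- v + (- (- u + comm (comm x (- u)) (- v) + u)
            - (- x + comm (comm (- v) (- x)) u + x)) + v).
  by rewrite /add_commutator !groupE.
have kNx : lcs k (- x) by apply: lcsN.
have kNvx : lcs k.+1 (comm (- v) (- x)).
  have ->: comm (- v) (- x) = - comm (- x) (- v).
    by rewrite /add_commutator !groupE.
  by apply: lcsN; apply: lcs_comm.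
apply: lcsN; apply: lcsJ; apply: lcsD; apply: lcsN; apply: lcsJ.
  by apply: lcs_comm; apply: lcs_comm.
exact: lcs_comm.
Qed.

(** * Hall's argument: from one term of the lower central series to the next *)

Section Hall.

Variables (G : set (A -> A)) (k : nat).
Hypothesis endoG : G `<=` endo.

(* Modulo [lcs k.+2], this is the image in [lcs k.+1] of the tensor product of *)
(* the displacement filtrations of [lcs k] and of A.                           *)
Let filtration s : set A := add_gen (lcs k.+2 `|`
  [set z | exists i j x y, [/\ (s <= i + j)%N, iter i (disp G) (lcs k) x,
     iter j (disp G) setT y & z = comm x y]]).

Let filtration_normal s : add_normal (filtration s).
Proof.
apply: (@normal_between_lcs k.+1); first exact: add_gen_subgroup.
  by move=> x kx; apply: sub_add_gen; left.
apply: add_gen_sub (lcs_subgroup _) _ => z [/lcsW //|[i [j [x [y]]]]].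
by case=> _ /(iter_disp_lcs endoG) kx _ ->; apply: lcs_comm.
Qed.

(** Expanding the commutator of [x + x'] and [y + y'] leaves, besides [comm x y], commutators with
    at least one displaced argument, and triple commutators in [lcs k.+2]. *)
Let disp_filtration s : disp G (filtration s) `<=` filtration s.+1.
Proof.
have [[_ FD _] FJ] := filtration_normal s.+1.
have sF z : lcs k.+2 z -> filtration s.+1 z by move=> kz; apply: sub_add_gen; left.
apply: disp_gen_sub => // z f [] + Gf; have fD := endoG Gf.
  by move=> /(disp_mem Gf)/(disp_lcs endoG)/sF.
case=> i [j [x [y [le_s Dx Dy ->]]]]; rewrite (endo_comm _ _ fD).
set x' := - x + f x; set y' := - y + f y.
have Dx' : iter i.+1 (disp G) (lcs k) x' by apply: disp_mem.
have Dy' : iter j.+1 (disp G) setT y' by apply: disp_mem.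
have -> : f x = x + x' by rewrite /x' !groupE.
have -> : f y = y + y' by rewrite /y' !groupE.
have Fcomm i' j' u v : (s.+1 <= i' + j')%N -> iter i' (disp G) (lcs k) u ->
    iter j' (disp G) setT v -> filtration s.+1 (comm u v).
  by move=> *; apply: sub_add_gen; right; exists i', j', u, v.
have kx := iter_disp_lcs endoG Dx.
have Fxy' : filtration s.+1 (comm x y').
  by apply: Fcomm Dx Dy'; rewrite addnS.
have Fx'y : filtration s.+1 (comm x' y).
  by apply: Fcomm Dx' Dy; rewrite addSn.
have Fx'y' : filtration s.+1 (comm x' y').
  by apply: Fcomm Dx' Dy'; rewrite addSn addnS ltnS leqW.
have ->: - comm x y + comm (x + x') (y + y') =
  (- comm x y + comm x y' + comm x y + comm (comm x y) y') +
  (comm (comm x (y + y')) x' + (comm x' y' + (- y' + comm x' y + y'))).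
  by rewrite /add_commutator !groupE.
have Fxyz u v : filtration s.+1 (comm (comm x u) v).
  by apply: sF; apply: lcs_comm; apply: lcs_comm.
by apply: (FD); apply: (FD); auto.
Qed.

(** By pigeonhole, [m + n <= i + j] forces [m <= i] or [n <= j]: either [x] has reached [lcs k.+1],
    or [y] has reached A' and [comm_lcs1] applies. *)
Lemma disp_lcsS m n :
  iter m (disp G) (lcs k) `<=` lcs k.+1 -> iter n (disp G) setT `<=` lcs 1 ->
  iter (m + n) (disp G) (lcs k.+1) `<=` lcs k.+2.
Proof.
move=> smk snT; apply: (@subset_trans _ (filtration (m + n))).
  elim: (m + n)%N => [|s IHs] /=.
    apply: add_genS => _ [x kx [y _ <-]]; right.
    by exists 0%N, 0%N, x, y.
  exact: subset_trans (dispS IHs) (@disp_filtration _).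
apply: add_gen_sub (lcs_subgroup _) _ => z [//|[i [j [x [y]]]]].
case=> le_mn Dx Dy ->; have [le_mi|lt_im] := leqP m i.
  by apply: lcs_comm; apply: (iter_disp_stable endoG le_mi smk).
have le_nj : (n <= j)%N.
  by rewrite -(leq_add2l m) (leq_trans le_mn) // leq_add2r ltnW.
apply: comm_lcs1; first exact: (iter_disp_lcs endoG Dx).
exact: (iter_disp_stable endoG le_nj snT).
Qed.

End Hall.

Lemma disp_nilpotent G n : nilpotent_type A -> G `<=` endo ->
  iter n (disp G) setT `<=` lcs 1 -> exists m, iter m (disp G) setT `<=` [set 0].
Proof.
case=> c c_gt0 lcs_c endoG sn.
have step k : exists m, iter m (disp G) (lcs k) `<=` lcs k.+1.
  elim: k => [|k [m smk]]; first by exists n.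
  by exists (m + n)%N; apply: disp_lcsS.
have [m sm] : exists m, iter m (disp G) setT `<=` lcs c.-1.
  elim: c.-1 => [|k [m IHm]]; first by exists 0%N.
  have [m' sm'] := step k; exists (m' + m)%N; rewrite iterD.
  exact: subset_trans (iter_dispS IHm) sm'.
by exists m; rewrite -lcs_c -(prednK c_gt0).
Qed.

(** Modulo A', the operators f - 1 and g - 1 commute, so a displacement by [G2] can be moved inward
    to A itself, where the last hypothesis trades it for one by [G1]. *)
Lemma disp_setU_sub G1 G2 n : G1 `<=` endo -> G2 `<=` endo ->
    (forall f g x, G1 f -> G2 g -> lcs 1 (- f (g x) + g (f x))) ->
    disp G2 setT `<=` disp G1 setT ->
  iter n (disp (G1 `|` G2)) setT `<=` add_gen (iter n (disp G1) setT `|` lcs 1).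
Proof.
move=> endo1 endo2 comm12 s21; pose P m := add_gen (iter m (disp G1) setT `|` lcs 1).
rewrite -/(P n).
have nP m : add_normal (P m).
  apply: (@normal_between_lcs 0) => //; first exact: add_gen_subgroup.
  by move=> x kx; apply: sub_add_gen; right.
have lcsP m f x : endo f -> lcs 1 x -> P m (- x + f x).
  move=> fD kx; apply: sub_add_gen; right.
  by apply: lcsD; [apply: lcsN | apply: lcs_endo].
have disp1 m f x : G1 f -> P m x -> P m.+1 (- x + f x).
  move=> G1f; have subP := displacement_subgroup (endo1 _ G1f) (nP m.+1).
  apply: (add_gen_sub subP) => {}x [Dx|] /=; last exact: lcsP (endo1 _ G1f).
  by apply: sub_add_gen; left; apply: disp_mem.
have disp2 m g x : G2 g -> P m x -> P m.+1 (- x + g x).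
  move=> G2g; have gD := endo2 _ G2g; elim: m x => [|m IHm].
    by move=> x _; apply: sub_add_gen; left; apply: s21; apply: disp_mem.
  have subQ := displacement_subgroup gD (nP m.+2).
  apply: (add_gen_sub subQ) => x [|] /=; last exact: lcsP.
  apply: (add_gen_sub subQ) => _ [y Dy [f G1f <-]] /=.
  have fD := endo1 _ G1f.
  have [[_ PD _] _] := nP m.+2.
  have : P m.+2 (- (- y + g y) + f (- y + g y)).
    by apply: disp1 => //; apply: IHm => //; apply: sub_add_gen; left.
  have Pc u v : P m.+2 (comm u v) by apply: sub_add_gen; right; apply: lcs_comm.
  have Pfg : P m.+2 (- f (g y) + g (f y)).
    by apply: sub_add_gen; right; apply: comm12 G1f G2g.
  set u := - _ + _ => Pu.
  (* Up to commutators this says (g - 1)(f - 1) y = (f - 1)(g - 1) y + (gf - fg) y. *)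
  have ->: - (- y + f y) + g (- y + f y) =
     (comm (f y) (- (y - g y)) + comm (- y) (g y)) + u + (- f (g y) + g (f y)).
    by rewrite /u /add_commutator fD gD (endoN _ fD) (endoN _ gD) !groupE.
  exact: PD _ _ (PD _ _ (PD _ _ (Pc _ _) (Pc _ _)) Pu) Pfg.
elim: n => [|n IHn]; first by move=> x _; apply: sub_add_gen; left.
apply: subset_trans (dispS IHn) _; apply: add_gen_sub; first exact: (nP _).1.
by move=> _ [x Px [f [G1f|G2f] <-]]; [apply: disp1 | apply: disp2].
Qed.

(** * The actions [lambda] and [mu] of a two-sided skew brace *)

Section TwoSided.

Hypotheses (A_two_sided : two_sided A) (A_nilpotent : nilpotent_type A).

Definition lambda a : A -> A := fun x => - a + a \circ x.

Definition mu a : A -> A := fun x => x \circ a - a.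

Lemma lambda_endo : range lambda `<=` endo.
Proof.
by move=> _ [a _ <-] x y; rewrite /lambda sb_left_distr !groupE.
Qed.

Lemma mu_endo : range mu `<=` endo.
Proof. by move=> _ [a _ <-] x y; rewrite /mu A_two_sided !groupE. Qed.

Lemma star_mu x y : star x y = - x + mu y x.
Proof. by rewrite /star /mu !groupE. Qed.

Lemma star_lambda x y : star x y = - (- - y + lambda x (- y)).
Proof.
have lD : endo (lambda x) by apply: lambda_endo; exists x.
by rewrite (endoN _ lD) /star /lambda !groupE.
Qed.

Lemma right_seriesE n : @right_series A n.+1 = iter n (disp (range mu)) setT.
Proof.
apply: eq_iter => X; congr add_gen; apply/seteqP; split=> z [x Xx].
  by case=> y _ <-; rewrite star_mu; exists x => //; exists (mu y) => //; exists y.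
by case=> _ [y _ <-] <-; rewrite -star_mu; exists x => //; exists y.
Qed.

(** By [star_lambda] the generators of the two sides correspond up to signs, which subgroups
    absorb. *)
Lemma left_seriesE n : @left_series A n.+1 = iter n (disp (range lambda)) setT.
Proof.
elim: n => [//|n IHn]; rewrite left_seriesS // IHn [RHS]/=.
have [_ _ DN] := iter_disp_subgroup (range lambda) n setT_subgroup.
have [_ _ sN] := add_gen_subgroup
  [set star x y | x in setT & y in iter n (disp (range lambda)) setT].
have [_ _ dN] := iter_disp_subgroup (range lambda) n.+1 setT_subgroup.
apply/seteqP; split; apply: add_gen_sub; try exact: add_gen_subgroup.
  move=> _ [x _ [y Dy <-]]; rewrite star_lambda; apply: dN.
  by apply: disp_mem; [exists x | apply: DN].
move=> _ [y Dy [_ [x _ <-] <-]].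
rewrite -[- y + _]oppK -{1 2}[y]oppK -star_lambda; apply: sN.
by apply: sub_add_gen; exists x => //; exists (- y) => //; apply: DN.
Qed.

(** By associativity of the circle operation, both composites involve the same [u] and [v], and both
    reduce to [u - v] modulo A'. *)
Lemma lambda_mu_comm f g x :
  range lambda f -> range mu g -> lcs 1 (- f (g x) + g (f x)).
Proof.
move=> [a _ <-] [c _ <-].
have lD : endo (lambda a) by apply: lambda_endo; exists a.
have mD : endo (mu c) by apply: mu_endo; exists c.
set u := a \circ x \circ c; set v := a \circ c.
have ->: lambda a (mu c x) = - a + u - v + a.
  by rewrite /mu lD (endoN _ lD) /lambda circA !groupE.
have ->: mu c (lambda a x) = c - v + u - c.
  by rewrite /lambda mD (endoN _ mD) /mu !groupE.
have ->: - (- a + u - v + a) + (c - v + u - c) =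
   comm a (u - v) + (comm (- v) u + (comm (- v + u) (- c))).
  by rewrite /add_commutator !groupE.
by apply: lcsD; [|apply: lcsD]; apply: lcs_comm.
Qed.

(** Both sides are A * A, the common second term of the left and right series. *)
Lemma disp_lambda_setT : disp (range lambda) setT = disp (range mu) setT.
Proof. by rewrite -[LHS](left_seriesE 1) -[RHS](right_seriesE 1). Qed.

Local Notation dispA := (disp (range lambda `|` range mu)).

Lemma lambda_mu_endo : range lambda `|` range mu `<=` endo.
Proof. by move=> f [/lambda_endo|/mu_endo]. Qed.

Lemma left_nilpotent_disp :
  left_nilpotent A -> exists m, iter m dispA setT `<=` [set 0].
Proof.
case=> [[//|n] _]; rewrite left_seriesE => D0.
apply: (@disp_nilpotent _ n A_nilpotent lambda_mu_endo).
apply: subset_trans (disp_setU_sub (n := n) lambda_endo mu_endo _ _) _.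
- by move=> f g x; apply: lambda_mu_comm.
- by rewrite disp_lambda_setT.
rewrite D0; apply: add_gen_sub (lcs_subgroup 1) _ => x [->|//].
exact: lcs0.
Qed.

Lemma right_nilpotent_disp :
  right_nilpotent A -> exists m, iter m dispA setT `<=` [set 0].
Proof.
case=> [[//|n] _]; rewrite right_seriesE setUC => D0.
apply: (@disp_nilpotent _ n A_nilpotent).
  by rewrite setUC; exact: lambda_mu_endo.
apply: subset_trans (disp_setU_sub (n := n) mu_endo lambda_endo _ _) _.
- move=> f g x muf lag.
  have ->: - f (g x) + g (f x) = - (- g (f x) + f (g x)) by rewrite !groupE.
  by apply: lcsN; apply: lambda_mu_comm lag muf.
- by rewrite disp_lambda_setT.
rewrite D0; apply: add_gen_sub (lcs_subgroup 1) _ => x [->|//].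
exact: lcs0.
Qed.

(* If i + j >= 2 ^ k.+1, then i or j is at least 2 ^ k.                        *)
Lemma strong_series_disp k n :
  (2 ^ k <= n)%N -> @strong_series A n `<=` iter k dispA setT.
Proof.
elim: k n => [//|k IHk] [|n le_n]; first by rewrite leqn0 expn_eq0.
have n_gt0 : (0 < n)%N.
  by rewrite -ltnS (leq_trans _ le_n) // -[1%N](expn0 2) ltn_exp2l.
have [_ _ DN] :=
  iter_disp_subgroup (range lambda `|` range mu) k setT_subgroup.
have subD := iter_disp_subgroup (range lambda `|` range mu) k.+1 setT_subgroup.
rewrite strong_seriesS //; apply: (add_gen_sub subD) => z [i /andP[_ le_in]].
apply: (add_gen_sub subD) => _ [x Sx [y Sy <-]].
(* A deep left factor is displaced by [mu y], a deep right factor by [lambda x]; hence both families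
   are needed in [dispA]. *)
have [le_ki|lt_ik] := leqP (2 ^ k) i.
  rewrite star_mu; apply: disp_mem; first by right; exists y.
  exact: IHk Sx.
have le_kni : (2 ^ k <= n.+1 - i)%N.
  rewrite leq_subRL ?(leq_trans le_in) // (leq_trans _ le_n) //.
  by rewrite expnS mul2n -addnn leq_add2r ltnW.
rewrite star_lambda; have [_ _ DSN] := subD.
apply: DSN; apply: disp_mem; first by left; exists x.
by apply: DN; apply: (IHk _ le_kni).
Qed.

Lemma strong_series_subgroup n : (1 <= n)%N -> add_subgroup (@strong_series A n).
Proof.
case: n => [//|[|n]] _; first exact: setT_subgroup.
by rewrite strong_seriesS //; apply: add_gen_subgroup.
Qed.

Lemma disp_strongly_nilpotent :
  (exists m, iter m dispA setT `<=` [set 0]) -> strongly_nilpotent A.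
Proof.
case=> m D0; exists (2 ^ m)%N; first by rewrite expn_gt0.
apply/seteqP; split; first exact: subset_trans (strong_series_disp _) D0.
by move=> _ ->; have [] := @strong_series_subgroup (2 ^ m) (expn_gt0 _ _).
Qed.

End TwoSided.

(** * Comparison of the one-sided series with the strong series *)

Lemma right_series_strong n : (1 <= n)%N -> @right_series A n `<=` @strong_series A n.
Proof.
elim: n => [//|[//|n] IHn _]; rewrite right_seriesS // strong_seriesS //.
apply: add_genS => _ [x Rx [y _ <-]].
exists n.+1; first by rewrite /= leqnn.
by rewrite subSnn; apply: sub_add_gen; exists x; [apply: IHn | exists y].
Qed.

Lemma left_series_strong n : (1 <= n)%N -> @left_series A n `<=` @strong_series A n.
Proof.
elim: n => [//|[//|n] IHn _]; rewrite left_seriesS // strong_seriesS //.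
apply: add_genS => _ [x _ [y Ly <-]].
exists 1%N => //; rewrite subn1.
by apply: sub_add_gen; exists x => //; exists y => //; apply: IHn.
Qed.

Lemma strongly_right_nilpotent : strongly_nilpotent A -> right_nilpotent A.
Proof.
case=> n n_gt0 S0; exists n => //; apply/seteqP; split.
  by rewrite -S0; apply: right_series_strong.
case: n n_gt0 {S0} => [//|[//|n]] _ _ ->.
by rewrite right_seriesS //; have [] := add_gen_subgroup
  [set star x y | x in @right_series A n.+1 & y in setT].
Qed.

Lemma strongly_left_nilpotent : strongly_nilpotent A -> left_nilpotent A.
Proof.
case=> n n_gt0 S0; exists n => //; apply/seteqP; split.
  by rewrite -S0; apply: left_series_strong.
case: n n_gt0 {S0} => [//|[//|n]] _ _ ->.
by rewrite left_seriesS //; have [] := add_gen_subgroup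
  [set star x y | x in setT & y in @left_series A n.+1].
Qed.

End Nilpotency.

Theorem theorem4p26 (A : skewBrace) (A_two_sided : two_sided A)
    (A_nilpotent_type : nilpotent_type A) :
  (left_nilpotent A <-> right_nilpotent A) /\
  (right_nilpotent A <-> strongly_nilpotent A).
Proof.
have left_strong : left_nilpotent A -> strongly_nilpotent A.
  move=> /left_nilpotent_disp-/(_ A_two_sided A_nilpotent_type).
  exact: disp_strongly_nilpotent.
have right_strong : right_nilpotent A -> strongly_nilpotent A.
  move=> /right_nilpotent_disp-/(_ A_two_sided A_nilpotent_type).
  exact: disp_strongly_nilpotent.
have strong_right := @strongly_right_nilpotent A.
have strong_left := @strongly_left_nilpotent A.
by split; split; auto.
Qed.
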